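(* There are universal constants $C_1,C_2>0$ such that for every integer $s\ge 2$ and every $n$-point metric space $(X,d)$ ($n\ge 2$) that excludes $K_{s,s}$ as a minor, $X$ embeds into $\ell_\infty^k$ with $k\le C_1 3^s(\log s)\log n$ and distortion at most $C_2 s^2$.
   Context: A metric space $(X,d)$ excludes $K_{s,s}$ as a minor if there is a graph $G$ with positive edge weights, whose vertex set contains $X$, which does not have the complete bipartite graph $K_{s,s}$ as a minor, such that $d$ is the restriction to $X$ of the shortest path metric of $G$. The distortion of an injective map $f$ is the least $K$ such that for some $c>0$, $cK^{-1}d(x,y)\le\|f(x)-f(y)\|_\infty\le c\,d(x,y)$ for all $x,y$. *)

(* Defs.v *)
From HB Require Import structures.
From mathcomp Require Import all_boot all_order all_algebra.
From mathcomp Require Import all_classical all_reals all_analysis.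
Set Implicit Arguments.
Unset Strict Implicit.
Unset Printing Implicit Defensive.
Import Order.TTheory GRing.Theory Num.Theory.
Import numFieldNormedType.Exports.
Local Open Scope classical_set_scope.
Local Open Scope ring_scope.

(* Simple graphs, possibly infinite. *)
Record sgraph := SGraph {
  vertex :> choiceType;
  adj : rel vertex;
  adj_sym : symmetric adj;
  adj_irr : irreflexive adj }.

Definition complete_bipartite_rel (m n : nat) : rel ('I_m + 'I_n) :=
  fun u v => match u, v with
             | inl _, inr _ | inr _, inl _ => true
             | _, _ => false
             end.

Lemma complete_bipartite_sym m n : symmetric (@complete_bipartite_rel m n).
Proof. by case=> ? [] ?. Qed.

Lemma complete_bipartite_irr m n : irreflexive (@complete_bipartite_rel m n).
Proof. by case. Qed.

Definition complete_bipartite (m n : nat) : sgraph :=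
  SGraph (@complete_bipartite_sym m n) (@complete_bipartite_irr m n).

Definition connected_in (G : sgraph) (B : set G) : Prop :=
  forall x y : G, B x -> B y -> exists p : seq G,
    [/\ path (@adj G) x p, last x p = y & forall z, z \in p -> B z].

(* H is obtained from a subgraph of G by contracting the branch sets B u. *)
Definition is_minor (H G : sgraph) : Prop :=
  exists B : H -> set G,
    [/\ forall u, B u !=set0,
        forall u, connected_in (B u),
        forall u v, u != v -> B u `&` B v = set0 &
        forall u v, adj u v -> exists x y, [/\ B u x, B v y & adj x y]].

Section PathMetric.
Context {R : realType}.

(* Only the values of w on the edges of G matter. *)
Definition is_edge_weight (G : sgraph) (w : G -> G -> R) : Prop :=
  forall x y, adj x y -> 0 < w x y /\ w x y = w y x.

Definition path_length (G : sgraph) (w : G -> G -> R) (x : G) (p : seq G) : R :=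
  \sum_(l <- pairmap w x p) l.

(* Infimum over all walks, which since weights are positive is the infimum over
   simple paths; it is a minimum when G is finite, and +oo when x and y lie in
   different components. *)
Definition path_dist (G : sgraph) (w : G -> G -> R) (x y : G) : \bar R :=
  ereal_inf [set (path_length w x p)%:E | p in
             [set p : seq G | path (@adj G) x p /\ last x p = y]].

Definition excludes_minor (X : metricType R) (H : sgraph) : Prop :=
  exists (G : sgraph) (w : G -> G -> R) (i : X -> G),
    [/\ is_edge_weight w, ~ is_minor H G, injective i &
        forall x y : X, (mdist x y)%:E = path_dist w (i x) (i y)].

(* The norm on 'rV[R]_k is the maximum of the absolute values of the
   coordinates, so that 'rV[R]_k is l_oo^k. *)
Definition distortion_le (X : metricType R) (k : nat) (f : X -> 'rV[R]_k)
    (K : R) : Prop :=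
  0 < K /\ exists2 c : R, 0 < c & forall x y : X,
    c * K^-1 * mdist x y <= `|f x - f y| <= c * mdist x y.

Definition is_distortion (X : metricType R) (k : nat) (f : X -> 'rV[R]_k)
    (K : R) : Prop :=
  distortion_le f K /\ forall K', distortion_le f K' -> K <= K'.

End PathMetric.

(* Main.v *)
Require Import Defs.
From HB Require Import structures.
From mathcomp Require Import all_boot all_order all_algebra.
From mathcomp Require Import all_classical all_reals all_analysis.
From mathcomp Require Import zify ring lra.
Set Implicit Arguments.
Unset Strict Implicit.
Unset Printing Implicit Defensive.
Import Order.TTheory GRing.Theory Num.Theory.
Import numFieldNormedType.Exports.

(* After scaling, the edge weights may be rounded to integers.  At scale eta,
   drop the edges longer than eta and, s times in succession, cut every
   component into bands of width 3 eta according to the distance to a root; a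
   band is shifted by a * eta with a = 0, 1 or 2.  If a final component had s
   points pairwise at distance more than (14 s + 6) eta, then going back
   through the rounds, geodesics from these points towards the successive roots
   would span a K_{s,s} minor (Klein-Plotkin-Rao, in the form of
   Fakcharoenphol-Talwar); hence the components have diameter O(s^2 eta).  In
   each round at most one shift cuts a given ball of radius < eta / 2, so two
   balls, at two different scales, are preserved by one of the 3^s sequences of
   shifts.

   For each sequence of shifts and each residue modulo L = O(log s), the scales
   2^j with j in that residue class give a nested hierarchy of clusters.  For
   each u <= log_2 n a point x lies in at most one cluster C with
   #|C| <= 2^u < #|parent C|, and the coordinates attached to u are the
   distances from x to the complement of C, truncated at the scale of C, split
   according to a digit of C among its siblings.  The digits come from an
   arithmetic code in which a child of relative size 2^-l needs about l digits,
   so that O(log n) coordinates encode all levels of the hierarchy at once.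
   Two points x and y at distance d are separated at the scale d / O(s^2) as
   soon as the one with the smaller ball of radius < d / 2 is well inside its
   cluster there and at the next scale of the hierarchy. *)

Local Open Scope nat_scope.

(** * Embedding from nested clusters *)

(** When [2 ^ u <= 2 * (B - A) < 4 * 2 ^ u], the two quotients differ by at least 1 and at most 4,
    hence also modulo 8. The doubling allows [2 ^ t] to exceed [M] by a factor below 2. *)
Lemma dyadic_digit_gap t A B M N : A + M <= B -> 2 ^ t < 2 * M -> B < N -> 2 ^ t < N ->
  exists2 u, t <= u /\ 2 ^ u < N & (2 * A %/ 2 ^ u) %% 8 != (2 * B %/ 2 ^ u) %% 8.
Proof.
move=> AB tM BN tN; have M0 : 0 < M by have := expn_gt0 2 t; lia.
have d0 : 0 < B - A by lia.
have /andP[h1 h2] := trunc_log_bounds (isT : 1 < 2) d0.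
set v := trunc_log 2 (B - A) in h1 h2.
have [u [tu uN u1 u2]] : exists u, [/\ t <= u, 2 ^ u < N, 2 ^ u <= 2 * (B - A) &
    2 * (B - A) < 4 * 2 ^ u].
  move: h2; rewrite expnS => h2.
  have [tv|vt] := leqP t v; first by exists v; split => //; lia.
  exists t; split => //; first lia.
  by have : 2 ^ v.+1 <= 2 ^ t by [rewrite leq_exp2l]; rewrite expnS; lia.
exists u => //.
have p0 : 0 < 2 ^ u by rewrite expn_gt0.
have h3 : (1 * 2 ^ u + 2 * A) %/ 2 ^ u <= 2 * B %/ 2 ^ u by apply: leq_div2r; lia.
have h4 : 2 * B %/ 2 ^ u <= (4 * 2 ^ u + 2 * A) %/ 2 ^ u by apply: leq_div2r; lia.
by move: h3 h4; rewrite !divnMDl //; move: (_ %/ _) (_ %/ _) => p q; lia.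
Qed.

Lemma dyadic_scale c n : 0 < c < n -> exists j, c * 2 ^ j < n <= c * 2 ^ j.+1.
Proof.
move=> /andP[c0 cn].
have q0 : 0 < n.-1 %/ c by rewrite divn_gt0 //; lia.
have /andP[h1 h2] := trunc_log_bounds (isT : 1 < 2) q0.
exists (trunc_log 2 (n.-1 %/ c)).
have h3 := leq_trunc_div n.-1 c; have h4 := ltn_ceil n.-1 c0.
have h5 : c * 2 ^ trunc_log 2 (n.-1 %/ c) <= c * (n.-1 %/ c) by rewrite leq_mul2l h1 orbT.
have h6 : c * (n.-1 %/ c).+1 <= c * 2 ^ (trunc_log 2 (n.-1 %/ c)).+1.
  by rewrite leq_mul2l h2 orbT.
lia.
Qed.

Section CappedMin.
Variables (T : finType) (P : pred T) (c : nat) (F : T -> nat).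

Lemma bigmin_cap : \big[minn/c]_(y | P y) F y <= c.
Proof. by elim/big_rec: _ => // i m _; rewrite geq_min => ->; rewrite orbT. Qed.

Lemma bigmin_inf y : P y -> \big[minn/c]_(z | P z) F z <= F y.
Proof.
move=> Py; have := mem_index_enum y; elim: (index_enum T) => // z s IH.
rewrite inE big_cons => /predU1P[<-|/IH]; first by rewrite Py geq_minl.
by case: ifP => // _; rewrite geq_min => ->; rewrite orbT.
Qed.

Lemma bigmin_ge n : n <= c -> (forall y, P y -> n <= F y) ->
  n <= \big[minn/c]_(y | P y) F y.
Proof. by move=> nc nF; elim/big_rec: _ => // i m /nF; rewrite leq_min => ->. Qed.
End CappedMin.

Section Embedding.
Variables (T S : finType) (d : T -> T -> nat) (K L : nat).
Variable clust : nat -> S -> rel T.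
Hypothesis d_refl : forall x, d x x = 0.
Hypothesis d_sym : forall x y, d x y = d y x.
Hypothesis d_tri : forall y x z, d x z <= d x y + d y z.
Hypothesis K_gt0 : 0 < K.
Hypothesis L_large : 22 * K <= 2 ^ L.
Hypothesis d_large : forall x y, x != y -> 16 * K < d x y.
Hypothesis clust_refl : forall r sigma x, clust r sigma x x.
Hypothesis clust_eq : forall r sigma x y, clust r sigma x y ->
  clust r sigma x =1 clust r sigma y.
Hypothesis clust_diam : forall r sigma x y, 0 < r -> clust r sigma x y -> d x y <= K * r.
(** A single [sigma] has to pad [x] at two radii, because separating [x] from [y] involves the
    cluster of [x] at one level and its parent at the next. *)
Hypothesis clust_pad : forall r r' x, 0 < r -> 0 < r' -> exists sigma, forall y,
  (d x y <= r -> clust r sigma x y) /\ (d x y <= r' -> clust r' sigma x y).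

Lemma L_gt0 : 0 < L.
Proof. by case: (posnP L) L_large => // ->; lia. Qed.

Section OneHierarchy.
Variables (sigma : S) (rho : nat).

(** The truncation level [cap m.+1] is half of [scale m]; the other half leaves room for [drift m]
    in [cluster_pad]. *)
Definition scale m := 2 * 2 ^ (L * m + rho).

Lemma scale_gt0 m : 0 < scale m.
Proof. by rewrite muln_gt0 expn_gt0. Qed.

Lemma scaleS m : scale m.+1 = 2 ^ L * scale m.
Proof. by rewrite /scale mulnS -addnA expnD mulnCA. Qed.

Lemma scale_growth m : 22 * K * scale m <= scale m.+1.
Proof. by rewrite scaleS leq_mul2r L_large orbT. Qed.

Definition center r x := odflt x [pick y | clust r sigma x y].

Lemma center_clust r x : clust r sigma x (center r x).
Proof. by rewrite /center; case: pickP. Qed.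

Lemma center_eq r x y : clust r sigma x y -> center r x = center r y.
Proof.
move=> xy; rewrite /center (eq_pick (clust_eq xy)).
by case: pickP => // /(_ y); rewrite clust_refl.
Qed.

(* Composing the center maps from fine to coarse makes the clusters nested, at
   the cost of moving boundaries by the diameter of the finer scales. *)
Fixpoint rep m x := if m is m'.+1 then center (scale m') (rep m' x) else x.

Definition drift m := if m is m'.+1 then 2 * (K * scale m') else 0.

Lemma drift_scale m : 11 * drift m <= scale m.
Proof. by case: m => [//|m] /=; have := scale_growth m; lia. Qed.

(** The displacements grow geometrically: by [drift_scale] the earlier ones add up to at most the
    last bound [K * scale m], whence the factor 2 in [drift]. *)
Lemma rep_drift m x : d x (rep m x) <= drift m.
Proof.
elim: m => [|m IH] /=; first by rewrite d_refl.
have h1 := clust_diam (scale_gt0 m) (center_clust (scale m) (rep m x)).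
have h2 := d_tri (rep m x) x (center (scale m) (rep m x)).
have h3 : scale m <= K * scale m by rewrite leq_pmull.
by have := drift_scale m; lia.
Qed.

Definition cluster m x := [set y | rep m y == rep m x].

Lemma mem_cluster m x y : (y \in cluster m x) = (rep m y == rep m x).
Proof. by rewrite inE. Qed.

Lemma cluster_refl m x : x \in cluster m x.
Proof. by rewrite mem_cluster. Qed.

Lemma rep_le m m' x y : m <= m' -> rep m x = rep m y -> rep m' x = rep m' y.
Proof. by move=> /subnK <-; elim: (m' - m) => //= k IH /IH ->. Qed.

Lemma cluster_eq m x y : rep m x = rep m y -> cluster m x = cluster m y.
Proof. by move=> e; apply/setP => z; rewrite !mem_cluster e. Qed.

Lemma cluster_sub m m' x : m <= m' -> cluster m x \subset cluster m' x.
Proof.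
by move=> mm'; apply/fintype.subsetP => y; rewrite !mem_cluster => /eqP /(rep_le mm') ->.
Qed.

Lemma cluster_diam m x y : y \in cluster m.+1 x -> d x y <= 4 * (K * scale m).
Proof.
rewrite mem_cluster => /eqP e.
have h1 := rep_drift m.+1 x; have h2 := rep_drift m.+1 y.
rewrite e d_sym in h2; have := d_tri (rep m.+1 x) x y.
by rewrite /drift in h1 h2; lia.
Qed.

(** [rep m x] and [rep m y] stray by at most [drift m] from [x] and [y], so both lie in the ball
    around [x] that [clust] keeps whole, and they get the same center. *)
Lemma cluster_pad m x y : (forall z, d x z <= scale m -> clust (scale m) sigma x z) ->
  d x y + drift m <= scale m -> y \in cluster m.+1 x.
Proof.
move=> pad dxy; rewrite mem_cluster /=.
have h1 := rep_drift m x; have h2 := rep_drift m y; have h3 := d_tri y x (rep m y).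
by rewrite -(center_eq (pad (rep m y) _)) -?(center_eq (pad (rep m x) _)) //; lia.
Qed.

(* Siblings are laid out by decreasing size, so that the offsets of two of them
   differ by at least the larger size. *)
Definition before m z x := (#|cluster m x| < #|cluster m z|) ||
  (#|cluster m x| == #|cluster m z|) && (enum_rank (rep m z) < enum_rank (rep m x)).

Definition offset m x := #|[set z in cluster m.+1 x | before m z x]|.

(** The points before [x] and the cluster of [x] are disjoint, and the offset of [y] counts all of
    them. *)
Lemma offset_before m x y : y \in cluster m.+1 x -> before m x y ->
  offset m x + #|cluster m x| <= offset m y.
Proof.
rewrite mem_cluster => /eqP e xy.
rewrite /offset -(cluster_eq e) -cardsUI.
have -> : [set z in cluster m.+1 y | before m z x] :&: cluster m x = finset.set0.
  apply/setP => z; rewrite !inE; apply/negbTE/negP => /andP[/andP[_]] + /eqP ez.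
  by rewrite /before (cluster_eq ez) ez !ltnn andbF.
rewrite cards0 addn0; apply/subset_leq_card/fintype.subsetP => z.
rewrite finset.in_setU => /orP[|]; rewrite !inE.
  move=> /andP[-> ]; move: xy; rewrite /before; lia.
move=> /eqP ez; rewrite (rep_le (leqnSn m) ez) e eqxx /=.
by move: xy; rewrite /before (cluster_eq ez) ez.
Qed.

Lemma before_total m x y : rep m x != rep m y -> before m x y || before m y x.
Proof.
move=> ne; have {}ne : (enum_rank (rep m x) : nat) != enum_rank (rep m y).
  by apply: contra ne => /eqP/val_inj/enum_rank_inj ->.
by rewrite /before; lia.
Qed.

Lemma offset_lt m x : offset m x < #|cluster m.+1 x|.
Proof.
apply: proper_card; apply/properP; split.
  by apply/fintype.subsetP => z; rewrite !inE => /andP[].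
exists x; first exact: cluster_refl.
by rewrite !inE /before !ltnn andbF andbF.
Qed.

Definition active m u x := #|cluster m x| <= 2 ^ u < #|cluster m.+1 x|.

Lemma active_uniq m m' u x : active m u x -> active m' u x -> m = m'.
Proof.
rewrite /active => h h'.
have mono a b : a <= b -> #|cluster a x| <= #|cluster b x|.
  by move=> ab; apply/subset_leq_card/cluster_sub.
have [lt|lt|//] := ltngtP m m'; have := mono _ _ lt; lia.
Qed.

Definition digit m u x := (2 * offset m x %/ 2 ^ u) %% 8.

Definition lit u e m x := active m u x && (digit m u x == e).

Definition cap m := if m is m'.+1 then 2 ^ (L * m' + rho) else 0.

Lemma cap_mono m m' : m < m' -> 2 * cap m <= cap m'.
Proof.
case: m => [|m]; case: m' => // m'; rewrite ltnS => mm' /=.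
rewrite -expnS leq_exp2l // -addSn leq_add2r.
by have := L_gt0; nia.
Qed.

(** The default [cap m] is at once the truncation and the value for an empty complement; it is 0 at
    level 0, where clusters are singletons. *)
Definition depth m x := \big[minn/cap m]_(y | y \notin cluster m x) d x y.

(* At most one level m is lit, by active_uniq. *)
Definition coordinate u e x :=
  if pselect (exists m, lit u e m x) is left h then depth (ex_minn h) x else 0.

Lemma coordinate_lit u e m x : lit u e m x -> coordinate u e x = depth m x.
Proof.
move=> lx; rewrite /coordinate; case: pselect => [h|[]]; last by exists m.
case: ex_minnP => m' /andP[act' _] _.
by move: lx => /andP[act _]; rewrite (active_uniq act act').
Qed.

Lemma coordinate_cases u e x :
  coordinate u e x = 0 \/ exists2 m, lit u e m x & coordinate u e x = depth m x.
Proof.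
have [[m lx]|no] := pselect (exists m, lit u e m x).
  by right; exists m => //; exact: coordinate_lit.
by left; rewrite /coordinate; case: pselect.
Qed.

Lemma lit_rep u e m x y : rep m x = rep m y -> lit u e m x = lit u e m y.
Proof.
move=> exy; have exy' := rep_le (leqnSn m) exy.
by rewrite /lit /active /digit /offset /before (cluster_eq exy) (cluster_eq exy') exy.
Qed.

(** If [y] shares the cluster lit at [x], both coordinates are truncated distances to the same
    complement; otherwise [y] lies outside it and [d x y] bounds the depth of [x]. *)
Lemma coordinate_lip u e x y : coordinate u e x <= coordinate u e y + d x y.
Proof.
have [->//|[m lx ->]] := coordinate_cases u e x.
have [exy|nxy] := eqVneq (rep m y) (rep m x); last first.
  apply: leq_trans (leq_addl _ _); apply: bigmin_inf.
  by rewrite mem_cluster.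
rewrite (coordinate_lit (m := m)); last by rewrite (lit_rep _ _ exy).
rewrite addnC -leq_subLR; apply: bigmin_ge.
  by rewrite leq_subLR; apply: leq_trans (bigmin_cap _ _ _) (leq_addl _ _).
move=> z; rewrite (cluster_eq exy) => zC; rewrite leq_subLR.
have h : depth m x <= d x z by exact: bigmin_inf.
by have := d_tri y x z; lia.
Qed.

(** It suffices to light level [m] at [x] but not at [y]: then [y] can only be lit at a lower level,
    as its higher clusters have more than [2 ^ u] points, and lower caps are at most half of
    [cap m]. *)
Lemma coordinate_separates m x y : y \in cluster m.+1 x -> y \notin cluster m x ->
  2 * #|cluster m x| <= #|cluster m.+1 x| -> depth m x = cap m ->
  exists u e, [/\ 2 ^ u < #|T|, e < 8 &
    cap m <= 2 * (coordinate u e x - coordinate u e y)].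
Proof.
move=> yD yC half dx.
have exD : rep m.+1 y = rep m.+1 x.
  by move: yD; rewrite mem_cluster => /eqP.
have neC : rep m y != rep m x by move: yC; rewrite mem_cluster.
have DT : #|cluster m.+1 x| <= #|T| by exact: max_card.
have cD := cluster_eq exD.
suff [u [e [uD lx ly]]] : exists u e, [/\ 2 ^ u < #|cluster m.+1 x|, lit u e m x &
    ~~ lit u e m y].
  exists u, e; split; [lia| |].
    by case/andP: lx => _ /eqP <-; rewrite ltn_mod.
  rewrite (coordinate_lit lx) dx.
  have [->|[m' lm' ->]] := coordinate_cases u e y; first lia.
  have mm' : m' < m.
    rewrite ltn_neqAle; apply/andP; split.
      by apply/eqP => E; rewrite -E lm' in ly.
    rewrite leqNgt; apply/negP => lt.
    have := subset_leq_card (cluster_sub y lt); rewrite cD.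
    by case/andP: lm' => /andP[h1 h2] _; lia.
  have h1 := cap_mono mm'.
  have h2 : depth m' y <= cap m' by exact: bigmin_cap.
  lia.
have C0 : 0 < #|cluster m x| by apply/card_gt0P; exists x; exact: cluster_refl.
(* The size of the cluster of [x] is rounded up to a power of two, which by [half] stays below the
   size of the parent. *)
have [t tC tC'] : exists2 t, #|cluster m x| <= 2 ^ t & 2 ^ t < 2 * #|cluster m x|.
  have /andP[h1 h2] := trunc_log_bounds (isT : 1 < 2) C0.
  set v := trunc_log 2 _ in h1 h2.
  have [E|ne] := eqVneq (2 ^ v) #|cluster m x|; first by exists v; lia.
  by exists v.+1; rewrite expnS in h2 *; lia.
(* If the cluster of [y] has more than [2 ^ t] points, [y] is inactive at [t]. Otherwise both
   siblings are active from [t] on, and a digit must tell them apart. *)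
have [tCy|Cyt] := ltnP (2 ^ t) #|cluster m y|.
  exists t, (digit m t x); split; first lia.
    by rewrite /lit eqxx andbT /active tC; lia.
  by rewrite /lit /active leqNgt tCy.
have [u [tu uD] ne] : exists2 u, t <= u /\ 2 ^ u < #|cluster m.+1 x| &
    digit m u x != digit m u y.
  have ox := offset_lt m x; have oy := offset_lt m y; rewrite cD in oy.
  have /orP[b|b] := before_total neC.
    have ob := offset_before (_ : x \in cluster m.+1 y) b.
    have [||||u h1 h2] := @dyadic_digit_gap t (offset m y) (offset m x)
      #|cluster m y| #|cluster m.+1 x|.
    - by apply: ob; rewrite mem_cluster exD.
    - move: b; rewrite /before; lia.
    - by [].
    - lia.
    by exists u; rewrite // eq_sym.
  have ob := offset_before yD b.
  by apply: (@dyadic_digit_gap t _ _ #|cluster m x|) => //; lia.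
have le2 : 2 ^ t <= 2 ^ u by rewrite leq_exp2l.
exists u, (digit m u x); split => //.
  by rewrite /lit eqxx andbT /active uD andbT; lia.
by rewrite /lit eq_sym (negbTE ne) andbF.
Qed.

End OneHierarchy.

(** The level has cap [2 ^ j] with [16 * K * 2 ^ j < d x y <= 32 * K * 2 ^ j]; a difference of half
    the cap then gives the factor [64 * K]. *)
Lemma separating_coordinate x y : x != y -> exists sigma (rho : 'I_L) u e,
  [/\ 2 ^ u < #|T|, e < 8 & d x y <= 64 * K *
     (coordinate sigma rho u e x - coordinate sigma rho u e y) \/
     d x y <= 64 * K *
     (coordinate sigma rho u e y - coordinate sigma rho u e x)].
Proof.
move=> nxy; pose ball r x := [set z | d x z <= r].
have [|j /andP[jd dj]] := @dyadic_scale (16 * K) (d x y).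
  by have := d_large nxy; lia.
wlog le : x y nxy jd dj / #|ball (8 * K * 2 ^ j) x| <= #|ball (8 * K * 2 ^ j) y|.
  move=> wl; have [le|/ltnW le] :=
    leqP #|ball (8 * K * 2 ^ j) x| #|ball (8 * K * 2 ^ j) y|.
    exact: wl.
  have [|||sigma [rho [u [e [h1 h2 h3]]]]] := wl y x _ _ _ le.
  - by rewrite eq_sym.
  - by rewrite d_sym.
  - by rewrite d_sym.
  exists sigma, rho, u, e; split => //; rewrite d_sym; tauto.
pose rho : 'I_L := Ordinal (ltn_pmod j L_gt0); pose m := j %/ L.
have Ej : L * m + rho = j by rewrite mulnC -divn_eq.
have Es : scale rho m = 2 * 2 ^ j by rewrite /scale Ej.
have Ec : cap rho m.+1 = 2 ^ j by rewrite /cap Ej.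
have [sigma pad] := clust_pad x (scale_gt0 rho m) (scale_gt0 rho m.+1).
have gr := scale_growth rho m; have dr := drift_scale rho m.
have subC : cluster sigma rho m.+1 x \subset ball (8 * K * 2 ^ j) x.
  by apply/fintype.subsetP => z /cluster_diam; rewrite Es inE; lia.
(* This is where 22 comes from: a radius of at most [40 * K * 2 ^ j] and a drift of [4 * K * 2 ^ j]
   add up to [22 * K * scale m]. *)
have subD z : d x z <= d x y + 8 * K * 2 ^ j -> z \in cluster sigma rho m.+2 x.
  move=> dz; apply: cluster_pad => [u /(pad u).2 //|].
  rewrite /drift Es; rewrite Es expnS in gr dj *; lia.
have [||||u [e [h1 h2 h3]]] := @coordinate_separates sigma rho m.+1 x y.
- by apply: subD; lia.
- apply/negP => /(fintype.subsetP subC); rewrite inE; lia.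
(* The disjoint balls around [x] and [y] lie in the parent cluster, and the smaller one, around [x],
   contains the cluster of [x]. *)
- apply: (@leq_trans (#|ball (8 * K * 2 ^ j) x| + #|ball (8 * K * 2 ^ j) y|)).
    by have := subset_leq_card subC; lia.
  rewrite -cardsUI.
  have -> : ball (8 * K * 2 ^ j) x :&: ball (8 * K * 2 ^ j) y = finset.set0.
    apply/setP => z; rewrite !inE; apply/negbTE/negP => /andP[dx dy].
    by have := d_tri z x y; rewrite (d_sym z); lia.
  rewrite cards0 addn0; apply/subset_leq_card/fintype.subsetP => z.
  rewrite finset.in_setU => /orP[|]; rewrite inE => dz; apply: subD; first lia.
  by have := d_tri y x z; lia.
- apply/eqP; rewrite eqn_leq; apply/andP; split; first exact: bigmin_cap.
  apply: bigmin_ge => // z zC; rewrite leqNgt; apply/negP => dz.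
  move/negP: zC; apply; apply: cluster_pad => [u /(pad u).1 //|].
  by rewrite Ec in dz; rewrite Es in dr *; lia.
exists sigma, rho, u, e; split => //; left.
rewrite Ec in h3; rewrite expnS in dj.
have := leq_mul (leqnn (32 * K)) h3; lia.
Qed.

Lemma finite_embedding : exists f :
    S * 'I_L * 'I_(trunc_log 2 #|T|).+1 * 'I_8 -> T -> nat,
  (forall i x y, f i x <= f i y + d x y) /\
  (forall x y, x != y -> exists i,
     d x y <= 64 * K * (f i x - f i y) \/ d x y <= 64 * K * (f i y - f i x)).
Proof.
exists (fun i : S * 'I_L * 'I_(trunc_log 2 #|T|).+1 * 'I_8 =>
  coordinate i.1.1.1 i.1.1.2 i.1.2 i.2); split.
  by move=> i x y; exact: coordinate_lip.
move=> x y /separating_coordinate[sigma [rho [u [e [h1 h2 h3]]]]].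
have hu : u < (trunc_log 2 #|T|).+1.
  have T0 : 0 < #|T| by apply/card_gt0P; exists x.
  by rewrite ltnS; apply: trunc_log_max => //; exact: ltnW.
by exists (sigma, rho, Ordinal hu, Ordinal h2).
Qed.

End Embedding.

Local Open Scope classical_set_scope.
Local Open Scope nat_scope.

(** * Walks and geodesics *)

Section Walks.
Variables (G : sgraph) (W : G -> G -> nat).

Inductive walk (H : set G) (x : G) : G -> nat -> Prop :=
| walk0 : H x -> walk H x x 0
| walkS y z n : walk H x y n -> adj y z -> H z -> walk H x z (n + W y z).

Lemma walk_in H x y n : walk H x y n -> H x /\ H y.
Proof. by elim=> // {}y z {}n _ [Hx _] _ Hz. Qed.

Lemma walk_sub (H H' : set G) x y n : H `<=` H' -> walk H x y n -> walk H' x y n.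
Proof.
move=> sHH'; elim=> [/sHH'|{}y z {}n _ IH yz /sHH' Hz]; first exact: walk0.
exact: walkS IH yz Hz.
Qed.

Lemma walk_cat H x y z m n : walk H x y m -> walk H y z n -> walk H x z (m + n).
Proof.
move=> xy; elim=> [_|u v k _ IH uv Hv]; first by rewrite addn0.
by rewrite addnA; apply: walkS IH uv Hv.
Qed.

Lemma walk_edge (H : set G) x y : H x -> H y -> adj x y -> walk H x y (W x y).
Proof. by move=> Hx Hy xy; rewrite -[W x y]add0n; apply: walkS (walk0 Hx) _ _. Qed.

Lemma walk_cross (P : set G) H x y n : walk H x y n -> P x -> ~ P y ->
  exists u v a b, [/\ walk H x u a, P u /\ ~ P v, adj u v, walk H v y b &
                      n = a + W u v + b].
Proof.
elim=> [//|{}y z {}n xy IH yz Hz] Px nPz.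
have [Py|nPy] := pselect (P y).
  by exists y, z, n, 0; split => //; [exact: walk0 | rewrite addn0].
have [u [v [a [b [xu Puv uv vy ->]]]]] := IH Px nPy.
by exists u, v, a, (b + W y z); split => //; [exact: walkS vy yz Hz | rewrite addnA].
Qed.

Lemma walk_path H x y n : walk H x y n -> exists p : seq G,
  [/\ path (@adj G) x p, last x p = y, forall z, z \in p -> H z &
      n = sumn (pairmap W x p)].
Proof.
elim=> [Hx|{}y z {}n _ [p [xp <- Hp ->]] yz Hz]; first by exists [::]; split.
exists (rcons p z); split; rewrite ?last_rcons ?rcons_path ?xp //.
  by move=> u; rewrite mem_rcons inE => /predU1P[->|/Hp].
by rewrite -cats1 pairmap_cat sumn_cat /= addn0.
Qed.

Lemma path_walk x p : path (@adj G) x p ->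
  walk setT x (last x p) (sumn (pairmap W x p)).
Proof.
elim/last_ind: p => [_|p z IH]; first exact: walk0.
rewrite rcons_path last_rcons => /andP[/IH xp yz].
rewrite -cats1 pairmap_cat sumn_cat /= addn0.
exact: walkS xp yz _.
Qed.

Hypothesis W_sym : forall x y : G, adj x y -> W x y = W y x.

Lemma walk_sym H x y n : walk H x y n -> walk H y x n.
Proof.
elim=> [|{}y z {}n xy IH yz Hz]; first exact: walk0.
rewrite addnC W_sym //; apply: walk_cat IH; apply: walk_edge => //.
  by case: (walk_in xy).
by rewrite adj_sym.
Qed.

Definition conn (H : set G) := forall x y, H x -> H y -> exists n, walk H x y n.

Lemma conn_connected_in H : conn H -> connected_in H.
Proof.
move=> cH x y Hx Hy; have [n /walk_path[p [xp py Hp _]]] := cH x y Hx Hy.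
by exists p.
Qed.

Lemma conn_from (H : set G) r :
  (forall z, H z -> exists n, walk H r z n) -> conn H.
Proof.
move=> rH x y /rH[m rx] /rH[n ry]; exists (m + n).
exact: walk_cat (walk_sym rx) ry.
Qed.

Definition component (H : set G) x : set G := [set y | exists n, walk H x y n].

Lemma component_self (H : set G) x : H x -> component H x x.
Proof. by move=> Hx; exists 0; exact: walk0. Qed.

Lemma component_sub H x : component H x `<=` H.
Proof. by move=> y [n xy]; case: (walk_in xy). Qed.

Lemma walk_component H x y n : walk H x y n -> walk (component H x) x y n.
Proof.
elim=> [Hx|{}y z {}n xy IH yz Hz]; first by apply/walk0/component_self.
by apply: (walkS IH yz); exists (n + W y z); exact: walkS xy yz Hz.
Qed.

Lemma conn_component H x : conn (component H x).
Proof. by apply: (@conn_from _ x) => z [n /walk_component]; exists n. Qed.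

Lemma component_walk_closed H x y z n : walk H y z n ->
  component H x y -> component H x z.
Proof. by move=> yz [m xy]; exists (m + n); exact: walk_cat xy yz. Qed.

Lemma component_eq H x y : component H x y -> component H y = component H x.
Proof.
move=> [n xy]; apply/seteqP; split=> z [m].
  by move=> /(walk_cat xy); exists (n + m).
by move=> /(walk_cat (walk_sym xy)); exists (n + m).
Qed.

Definition wdist (H : set G) x y : nat :=
  if pselect (exists n, `[< walk H x y n >]) is left h then ex_minn h else 0.

Lemma wdist_le H x y n : walk H x y n -> wdist H x y <= n.
Proof.
move=> xy; rewrite /wdist; case: pselect => // h.
by case: ex_minnP => m _; apply; apply/asboolP.
Qed.

Lemma wdist_walk H x y : (exists n, walk H x y n) -> walk H x y (wdist H x y).
Proof.
move=> [n xy]; rewrite /wdist; case: pselect => [h|[]]; last by exists n; apply/asboolP.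
by case: ex_minnP => m /asboolP.
Qed.

Section Geodesics.
Variables (H : set G) (r : G).
Hypotheses (cH : conn H) (Hr : H r).

Lemma wdist_from x : H x -> walk H r x (wdist H r x).
Proof. by move=> Hx; apply: wdist_walk; exact: cH. Qed.

Lemma wdist_root : wdist H r r = 0.
Proof. by apply/eqP; rewrite -leqn0; apply: wdist_le; exact: walk0. Qed.

Lemma wdist_lip x y n : walk H x y n -> wdist H r y <= wdist H r x + n.
Proof.
move=> xy; have [Hx _] := walk_in xy.
by apply: wdist_le; apply: walk_cat xy; exact: wdist_from.
Qed.

Lemma wdist_lip' x y n : walk H x y n -> wdist H r x <= wdist H r y + n.
Proof. by move=> /walk_sym; exact: wdist_lip. Qed.

(** Since [wdist] changes by at most the length of a walk, a walk that realises the full drop does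
    so on every prefix. *)
Lemma walk_geodesic x y n : walk H x y n -> wdist H r y + n = wdist H r x ->
  walk [set z | [/\ H z, wdist H r y <= wdist H r z <= wdist H r x &
                    exists2 a, walk H x z a & wdist H r z + a = wdist H r x]] x y n.
Proof.
elim=> [Hx _|{}y z {}n xy IH yz Hz Eq].
  by apply: walk0; split; rewrite ?leqnn //; exists 0; [exact: walk0|rewrite addn0].
have [_ Hy] := walk_in xy.
have h1 := wdist_lip' xy; have h2 := wdist_lip' (walk_edge Hy Hz yz).
have e1 : wdist H r y + n = wdist H r x by lia.
apply: (walkS _ yz).
  apply: walk_sub (IH e1) => u [Hu h3 h4]; split => //; lia.
split=> //; first lia.
by exists (n + W y z) => //; exact: walkS xy yz Hz.
Qed.

Lemma walk_to_ball c x : H x -> wdist H r x < c ->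
  exists n, walk [set z | H z /\ wdist H r z < c] r x n.
Proof.
move=> Hx lt; have h := wdist_from Hx; exists (wdist H r x); apply: walk_sym.
apply: walk_sub (@walk_geodesic x r _ (walk_sym h) _); last by rewrite wdist_root.
by move=> z [Hz h1 _]; split => //; lia.
Qed.

Lemma geodesic_cross c x : H x -> 0 < c <= wdist H r x ->
  exists u v a, [/\ walk H x u a /\ wdist H r u + a = wdist H r x,
                    c <= wdist H r u /\ wdist H r v < c, adj u v, H v &
                    wdist H r u = W u v + wdist H r v].
Proof.
move=> Hx /andP[c0 cx].
have [||u [v [a [b [xu [h1 h2] uv vr Eq]]]]] :=
  walk_cross (P := [set z | c <= wdist H r z]) (walk_sym (wdist_from Hx)) => //=.
  by rewrite wdist_root; lia.
have [_ Hu] := walk_in xu; have [Hv _] := walk_in vr.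
have h3 := wdist_le (walk_sym vr); have h4 := wdist_lip' xu.
have h5 := wdist_lip' (walk_edge Hu Hv uv).
move: h1 h2 => /= h1 /negP h2.
exists u, v, a; split => //; first (by split=> //; lia); last lia.
by split=> //; lia.
Qed.
End Geodesics.

End Walks.

(** * Decomposition of graphs without bipartite minors *)

Section Decomposition.
Variables (G : sgraph) (W : G -> G -> nat) (eta : nat).
Hypothesis W_sym : forall x y : G, adj x y -> W x y = W y x.
Hypothesis W_le : forall x y : G, adj x y -> W x y <= eta.
Hypothesis eta_gt0 : 0 < eta.

Section BipartiteModels.
Variables (t : nat) (x : 'I_t -> G).

(* A model in H of the complete bipartite graph with sides m and t, whose
   branch set B k contains the tip y k; the tip is close to x k, and far inside
   H from all A i.  The sets B k are disjoint because the x k will be taken far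
   apart. *)
Record model (H : set G) (m r : nat) (A : nat -> set G) (B : 'I_t -> set G)
    (y : 'I_t -> G) : Prop := Model {
  model_A_sub : forall i, i < m -> A i `<=` H;
  model_A_neq0 : forall i, i < m -> A i !=set0;
  model_A_conn : forall i, i < m -> conn W (A i);
  model_A_disj : forall i j z, i < m -> j < m -> A i z -> A j z -> i = j;
  model_B_sub : forall k, B k `<=` H;
  model_B_conn : forall k, conn W (B k);
  model_B_tip : forall k, B k (y k);
  model_B_near : forall k z, B k z ->
    exists2 n, n <= r + 3 * eta & walk W setT (x k) z n;
  model_tip_near : forall k, exists2 n, n <= r & walk W setT (x k) (y k) n;
  model_AB_disj : forall i k z, i < m -> A i z -> B k z -> False;
  model_AB_adj : forall i k, i < m -> exists a b, [/\ A i a, B k b & adj a b];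
  model_guard : forall i k z n, i < m -> walk W H (y k) z n -> n < 3 * eta ->
    A i z -> False }.

(* One round backwards: the new set A m is a ball around r that stops 7 eta
   short of the band H', each B k grows by the geodesics from its tip down to
   that ball, and the new tips lie 3 eta below the band, so that the walk of the
   next round leaves H before it meets H' or the ball. *)
Lemma model_step (H H' : set G) (r : G) (D m R : nat) A B y :
  conn W H -> H r -> H' `<=` H ->
  (forall z, H' z -> D <= wdist W H r z < D + 3 * eta) ->
  (forall v z n, walk W [set u | H u /\ D <= wdist W H r u <= wdist W H r v] v z n ->
     H' v -> H' z) ->
  7 * eta < D ->
  model H' m R A B y ->
  exists A' B' y', model H m.+1 (R + 7 * eta) A' B' y'.
Proof.
move=> cH Hr sH' depH' clH' D7 g.
pose dep z := wdist W H r z.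
have H'y k : H' (y k) by apply: model_B_sub g _ _ (model_B_tip g k).
have Hy k : H (y k) by exact: sH'.
have tipE k : exists v a, [/\ walk W H (y k) v a, dep v + a = dep (y k),
    dep v < D - 3 * eta & D - 4 * eta <= dep v].
  have /andP[d1 d2] := depH' _ (H'y k).
  have [|u [v [a [[h1 h2] [h3 h4] h5 h6 h7]]]] :=
    geodesic_cross W_sym cH Hr (c := D - 3 * eta) (Hy k); first by lia.
  have h8 := W_le h5.
  exists v, (a + W u v); split; rewrite /dep //; [|lia|lia].
  exact: walkS h1 h5 h6.
have [y' /all_sig[a' y'P]] : {y' : 'I_t -> G & forall k, {a | [/\ walk W H (y k) (y' k) a,
    dep (y' k) + a = dep (y k), dep (y' k) < D - 3 * eta & D - 4 * eta <= dep (y' k)]}}.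
  have /choice[y' hy'] := tipE.
  by exists y' => k; apply: cid; exact: hy'.
pose An : set G := [set z | H z /\ dep z < D - 7 * eta].
pose I k : set G := [set z | [/\ H z, D - 7 * eta <= dep z &
                      exists2 a, walk W H (y k) z a & dep z + a = dep (y k)]].
have IconnE k z : I k z -> exists n, walk W (I k) (y k) z n.
  move=> [Hz dz [a yz e]]; exists a.
  apply: walk_sub (walk_geodesic W_sym cH Hr yz e) => u [Hu /andP[h1 h2] h3].
  by split=> //; rewrite /dep in dz *; lia.
have depy k : D <= dep (y k) < D + 3 * eta by apply: depH'.
have Iy k : I k (y k).
  split=> //; first by have := depy k; lia.
  by exists 0; [exact: walk0|lia].
have Iy' k : I k (y' k).
  have [h1 h2 h3 h4] := y'P k; split; [by case: (walk_in h1)|lia|].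
  by exists (a' k).
have AnH' z : An z -> H' z -> False by move=> [_ h1] /depH'; rewrite -/(dep z); lia.
(* A geodesic from the tip to a point of [A i] would stay in the band, hence in [H'], and be shorter
   than [3 * eta], against [model_guard]. *)
have IA k i z : i < m -> I k z -> A i z -> False.
  move=> im [Hz dz [a yz e]] Az.
  have H'z := model_A_sub g im Az; have := depH' _ H'z; rewrite -/(dep z) => dz'.
  have dy := depy k.
  have yz' := walk_geodesic W_sym cH Hr yz e.
  suff yz3 : walk W H' (y k) z a by apply: (model_guard g im yz3 _ Az); lia.
  have yz2 : walk W (component W
      [set u | H u /\ D <= wdist W H r u <= wdist W H r (y k)] (y k)) (y k) z a.
    apply: walk_component; apply: walk_sub yz' => u [Hu h _]; split => //.
    by move: h; rewrite -/(dep z) -/(dep (y k)) -/(dep u); lia.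
  by apply: walk_sub yz2 => u [n yu]; exact: clH' yu (H'y k).
exists (fun i => if i == m then An else A i), (fun k => B k `|` I k), y'.
split.
- move=> i im; case: eqP => [_ z []//|/eqP ne]; apply: subset_trans sH'.
  by apply: model_A_sub g _ _; lia.
- move=> i im; case: eqP => [_|/eqP ne]; last by apply: model_A_neq0 g _ _; lia.
  by exists r; split => //; rewrite /dep wdist_root //; lia.
- move=> i im; case: eqP => [_|/eqP ne]; last by apply: model_A_conn g _ _; lia.
  by apply: (conn_from W_sym (r := r)) => z [Hz dz]; exact: walk_to_ball.
- move=> i j z im jm; case: eqP => [->|/eqP ni]; case: eqP => [->//|/eqP nj].
  + by move=> Az A'z; case: (AnH' z Az); apply: model_A_sub g _ _ _ A'z; lia.
  + by move=> A'z Az; case: (AnH' z Az); apply: model_A_sub g _ _ _ A'z; lia.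
  + by apply: model_A_disj g _ _ _ _ _; lia.
- by move=> k z [/(model_B_sub g)/sH'//|[]].
- move=> k; apply: (conn_from W_sym (r := y k)) => z [Bz|/IconnE[n yz]].
    have [n yz] := model_B_conn g (model_B_tip g k) Bz.
    by exists n; apply: walk_sub yz; left.
  by exists n; apply: walk_sub yz; right.
- by move=> k; right.
(* A geodesic descends from below [D + 3 * eta] to no less than [D - 7 * eta]; its length is below
   [10 * eta], which is [7 * eta] plus the allowed [3 * eta]. *)
- move=> k z [/(model_B_near g)[n nR xz]|[Hz dz [a yz e]]].
    by exists n => //; lia.
  have [n nR xy] := model_tip_near g k; exists (n + a).
    by have := depy k; lia.
  by apply: walk_cat xy _; apply: walk_sub yz.
- move=> k; have [n nR xy] := model_tip_near g k; exists (n + a' k).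
    by have := depy k; have [] := y'P k; lia.
  by apply: walk_cat xy _; have [yy _ _ _] := y'P k; apply: walk_sub yy.
- move=> i k z im.
  case: eqP => [_ Az [/(model_B_sub g)/(AnH' _ Az)//|[_]]|/eqP ne Az [Bz|Iz]].
  + by case: Az => _; lia.
  + by apply: (model_AB_disj g _ Az Bz); lia.
  + by apply: (IA k i z) => //; lia.
- move=> i k im; case: eqP => [_|/eqP ne]; last first.
    have [|a [b [h1 h2 h3]]] := model_AB_adj g k (i := i); first lia.
    by exists a, b; split => //; left.
  have [|u [v [a [[h1 h2] [h3 h4] h5 h6 h7]]]] :=
    geodesic_cross W_sym cH Hr (c := D - 7 * eta) (Hy k).
    by have := depy k; rewrite /dep; lia.
  exists v, u; split => //; last by rewrite adj_sym.
  right; split => //; first by case: (walk_in h1).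
  by exists a.
(* The new tips have depth at least [D - 4 * eta] and below [D - 3 * eta]; a change of less than
   [3 * eta] reaches neither the ball below [D - 7 * eta] nor the band at [D]. *)
- move=> i k z n im yz nlt.
  have [h1 h2 h3 h4] := y'P k.
  have h5 := wdist_lip cH Hr yz; have h6 := wdist_lip' W_sym cH Hr yz.
  rewrite -/(dep z) -/(dep (y' k)) in h5 h6.
  case: eqP => [_ [_]|/eqP ne]; first lia.
  have im' : i < m by lia.
  by move=> /(model_A_sub g im')/depH'; rewrite -/(dep z); lia.
Qed.

Lemma model_minor (H : set G) R A B y : model H t R A B y ->
  (forall k l n, k != l -> walk W setT (x k) (x l) n -> 2 * R + 6 * eta < n) ->
  is_minor (complete_bipartite t t) G.
Proof.
move=> g far.
exists (fun u : complete_bipartite t t => match u with inl i => A i | inr k => B k end).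
split.
- case=> [i|k]; first exact: (model_A_neq0 g (ltn_ord i)).
  by exists (y k); exact: model_B_tip g k.
- case=> [i|k]; apply: (@conn_connected_in _ W).
    exact: (model_A_conn g (ltn_ord i)).
  exact: model_B_conn g k.
- case=> [i|k] [j|l] ne; rewrite -subset0 => z [h1 h2] /=.
  + move/negP: ne; apply; apply/eqP; congr inl; apply: val_inj.
    exact: (model_A_disj g (ltn_ord i) (ltn_ord j) h1 h2).
  + exact: (model_AB_disj g (ltn_ord i) h1 h2).
  + exact: (model_AB_disj g (ltn_ord j) h2 h1).
  + have {}ne : k != l by apply: contra ne => /eqP->.
    have [n nR xz] := model_B_near g h1; have [n' nR' xz'] := model_B_near g h2.
    by have := far _ _ _ ne (walk_cat xz (walk_sym W_sym xz')); lia.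
- case=> [i|k] [j|l] /= => [//|_|_|//].
    exact: (model_AB_adj g l (ltn_ord i)).
  have [a [b [h1 h2 h3]]] := model_AB_adj g k (ltn_ord j).
  by exists b, a; split => //; rewrite adj_sym.
Qed.

End BipartiteModels.

(** For nonempty [H] the root [xget x H] depends on [H] only ([xget_default]), so all points of a
    cell measure depth from the same root. *)
Definition band (H : set G) (x : G) (a : nat) (v : G) : nat :=
  (wdist W H (xget x H) v %/ eta + a) %/ 3.

(* The head of sigma is the shift used in the last round. *)
Fixpoint cell (sigma : seq nat) (x : G) : set G :=
  if sigma is a :: sigma' then
    let H := cell sigma' x in
    component W [set v | H v /\ band H x a v = band H x a x] x
  else component W setT x.

Lemma cell_self sigma x : cell sigma x x.
Proof. by elim: sigma => [|a sigma IH]; apply: component_self. Qed.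

Lemma conn_cell sigma x : conn W (cell sigma x).
Proof. by case: sigma => [|a sigma]; exact: conn_component. Qed.

Lemma xget_default (H : set G) x y z : H z -> xget x H = xget y H.
Proof.
move=> Hz; rewrite /xget; case: pselect => // h.
by case: h; exists z; rewrite inE.
Qed.

Lemma cell_root sigma x : cell sigma x (xget x (cell sigma x)).
Proof. exact: xgetI (cell_self sigma x). Qed.

Lemma cell_eq sigma x y : cell sigma x y -> cell sigma y = cell sigma x.
Proof.
elim: sigma => [|a sigma IH] /=; first exact: component_eq.
move=> xy; have [/IH Exy Eb] := component_sub xy.
rewrite Exy -(component_eq W_sym xy).
have -> : band (cell sigma x) y a = band (cell sigma x) x a.
  by rewrite /band (@xget_default _ y x x) //; exact: cell_self.
by rewrite Eb.
Qed.

Lemma cell_model t (x : 'I_t -> G) x0 sigma m R A B y : 1 < t ->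
  model x (cell sigma x0) m R A B y ->
  (forall k l n, k != l -> walk W setT (x k) (x l) n ->
     2 * (R + 7 * eta * size sigma) + 6 * eta < n) ->
  exists A' B' y',
    model x (cell [::] x0) (m + size sigma) (R + 7 * eta * size sigma) A' B' y'.
Proof.
move=> t1; elim: sigma m R A B y => [|a sigma IH] m R A B y g far.
  by exists A, B, y; rewrite muln0 !addn0.
set H := cell sigma x0; set r := xget x0 H.
have cH : conn W H by exact: conn_cell.
have Hr : H r by exact: cell_root.
(* [D] is the depth at which band [q] starts; truncated subtraction takes care of an incomplete
   first band. *)
set q := band H x0 a x0; pose D := eta * (3 * q - a).
have bandP v : H v -> band H x0 a v = q -> D <= wdist W H r v < D + 3 * eta.
  move=> Hv; rewrite /band -/r => Eq; rewrite /D.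
  have h1 := leq_trunc_div (wdist W H r v) eta.
  have h2 := ltn_ceil (wdist W H r v) eta_gt0.
  move: Eq h1 h2; move: (q) (_ %/ eta) => p c Eq h1 h2.
  have : 3 * p - a <= c < 3 * p - a + 3 by lia.
  move: (3 * p - a) => u h3.
  apply/andP; split; first by apply: leq_trans h1; rewrite mulnC leq_mul2r; lia.
  have -> : eta * u + 3 * eta = (u + 3) * eta by lia.
  by apply: leq_trans h2 _; rewrite leq_mul2r; lia.
have sH' : cell (a :: sigma) x0 `<=` H by move=> z /component_sub[].
have depH' z : cell (a :: sigma) x0 z -> D <= wdist W H r z < D + 3 * eta.
  by move=> /component_sub[]; exact: bandP.
have clH' v z n : walk W [set u | H u /\ D <= wdist W H r u <= wdist W H r v] v z n ->
    cell (a :: sigma) x0 v -> cell (a :: sigma) x0 z.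
  move=> vz H'v; have [Hv Ev] := component_sub H'v.
  apply: component_walk_closed H'v; apply: walk_sub vz => u [Hu /andP[h1 h2]].
  split=> //; move: Ev; rewrite -/H -/q /band -/r => Ev.
  have h3 := leq_div2r eta h2; have := leq_div2r eta h1.
  by rewrite /D mulKn // => h4; lia.
(* A band starting within [7 * eta] of the root would put two of the [x k] at distance at most
   [2 * R + 20 * eta], which [far] excludes: the current round alone contributes [14 * eta], besides
   the final [6 * eta]. *)
have D7 : 7 * eta < D.
  rewrite ltnNge; apply/negP => D7.
  pose k0 : 'I_t := Ordinal (ltnW t1); pose k1 : 'I_t := Ordinal t1.
  have near k : exists2 n, n <= R + 10 * eta & walk W setT r (x k) n.
    have [n nR xy] := model_tip_near g k.
    have H'y := model_B_sub g (model_B_tip g k).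
    have h1 := wdist_from cH Hr (sH' _ H'y); have h2 := depH' _ H'y.
    exists (wdist W H r (y k) + n); first lia.
    by apply: walk_cat (walk_sym W_sym xy); apply: walk_sub h1.
  have [n nR rk0] := near k0; have [n' nR' rk1] := near k1.
  have := far k0 k1 _ isT (walk_cat (walk_sym W_sym rk0) rk1).
  by rewrite /=; lia.
have [A1 [B1 [y1 g1]]] := model_step cH Hr sH' depH' clH' D7 g.
have [|A2 [B2 [y2 g2]]] := IH _ _ _ _ _ g1.
  by move=> k l n kl /(far _ _ _ kl) /=; lia.
by exists A2, B2, y2; move: g2; rewrite addSnnS /= mulnS addnA.
Qed.

Lemma walk_setT_component x y z n : component W setT x y -> walk W setT y z n ->
  walk W (component W setT x) y z n.
Proof. by move=> xy /walk_component; rewrite (component_eq W_sym xy). Qed.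

(* A long walk inside a cell meets s points that are pairwise far apart, and
   these span a bipartite minor. *)
Lemma cell_diam s x y sigma : 1 < s -> size sigma = s ->
  ~ is_minor (complete_bipartite s s) G -> cell sigma x y ->
  exists2 n, n <= 18 * s ^ 2 * eta & walk W setT x y n.
Proof.
move=> s1 sz noM xy; apply: contrapT => farxy; apply: noM.
set H := component W setT x; have cH : conn W H by exact: conn_component.
have Hx : H x by exact: component_self.
(* [s] rounds require a separation of [(14 * s + 6) * eta]; the surplus [2 * eta] absorbs the error
   [eta] in placing the points and makes the bound strict. *)
pose S := (14 * s + 8) * eta.
have cellT z : cell sigma x z -> H z.
  by move=> /(conn_cell (cell_self sigma x))[n xz]; exists n; apply: walk_sub xz.
have ygt : s * S < wdist W H x y.
  rewrite ltnNge; apply/negP => le; apply: farxy; exists (wdist W H x y); last first.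
    by apply: walk_sub (wdist_from cH Hx (cellT _ xy)).
  (* [14 * s + 8 <= 18 * s] because [2 <= s]. *)
  by apply: leq_trans le _; rewrite /S mulnA leq_mul2r; apply/orP; right; nia.
have pt (k : 'I_s) : exists2 z, cell sigma x z & k * S <= wdist W H x z <= k * S + eta.
  have [k0|k0] := posnP k.
    by exists x; [exact: cell_self|rewrite wdist_root // k0].
  have [n wxy] := conn_cell (cell_self sigma x) xy.
  have S0 : 0 < S by rewrite muln_gt0 eta_gt0 addn_gt0 orbT.
  have [||u [v [a [b [xu [h1 h2] uv vy _]]]]] :=
    walk_cross (P := [set z | wdist W H x z < k * S]) wxy.
  - by rewrite /= wdist_root // muln_gt0 k0.
  - move=> /= lt; have: k * S <= s * S by rewrite leq_mul2r (ltnW (ltn_ord k)) orbT.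
    lia.
  have [_ Cu] := walk_in xu; have [Cv _] := walk_in vy.
  exists v => //; move: h1 h2 => /= h1 /negP h2.
  have := wdist_lip cH Hx (walk_edge W (cellT _ Cu) (cellT _ Cv) uv).
  by have := W_le uv; lia.
have [z zP] : {z : 'I_s -> G & forall k,
    cell sigma x (z k) /\ k * S <= wdist W H x (z k) <= k * S + eta}.
  have /choice[z zP] : forall k : 'I_s, exists z,
      cell sigma x z /\ k * S <= wdist W H x z <= k * S + eta.
    by move=> k; have [z] := pt k; exists z.
  by exists z.
have far_lt (k l : 'I_s) n : k < l -> walk W setT (z k) (z l) n ->
    (14 * s + 6) * eta < n.
  move=> kl /(walk_setT_component (cellT _ (zP k).1)) /(wdist_lip cH Hx) h.
  have [_ h1] := zP k; have [_ h2] := zP l.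
  have h3 : k.+1 * S <= l * S by rewrite leq_mul2r kl orbT.
  have h4 : S = (14 * s + 6) * eta + 2 * eta by rewrite -mulnDl -addnA.
  by move: h3; rewrite mulSn; lia.
have far (k l : 'I_s) n : k != l -> walk W setT (z k) (z l) n ->
    (14 * s + 6) * eta < n.
  by rewrite neq_ltn => /orP[kl w|kl /(walk_sym W_sym) w]; exact: (far_lt _ _ _ kl w).
(* The induction starts with no sets [A] and with each [B k] reduced to the point [z k]. *)
have [|||A [B [p g]]] := @cell_model s z x sigma 0 0 (fun=> set0)
    (fun k => [set z k]) z => //.
- split=> //; first by move=> k u ->; exact: (zP k).1.
  + by move=> k u v -> ->; exists 0; exact: walk0.
  + by move=> k u ->; exists 0 => //; exact: walk0.
  + by move=> k; exists 0 => //; exact: walk0.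
- by move=> k l n kl /(far _ _ _ kl); rewrite sz; lia.
rewrite sz add0n in g; apply: model_minor g _ => k l n kl /(far _ _ _ kl); lia.
Qed.

Definition padded sigma x rho :=
  forall y n, walk W setT x y n -> n <= rho -> cell sigma x y.

Lemma padded_nil x rho : padded [::] x rho.
Proof. by move=> y n xy _; exists n. Qed.

Lemma padded_cons sigma x rho : 2 * rho < eta -> padded sigma x rho ->
  exists e, forall a, a < 3 -> a != e -> padded (a :: sigma) x rho.
Proof.
move=> rho_lt pad; set H := cell sigma x; set r := xget x H.
have cH : conn W H by exact: conn_cell.
have Hx : H x by exact: cell_self.
have Hr : H r by exact: cell_root.
pose lo := wdist W H r x - rho.
(* Depths in the ball span less than [eta], so their quotients are [lo %/ eta] or one more. A band
   boundary separates these only if [lo %/ eta + a] is 2 modulo 3; solving for [a] uses that -1 is 2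
   modulo 3. *)
exists ((2 + 2 * (lo %/ eta)) %% 3) => a a3 ae.
have bandP v : lo <= wdist W H r v <= lo + 2 * rho ->
    band H x a v = (lo %/ eta + a) %/ 3.
  move=> /andP[h1 h2]; rewrite /band -/r.
  have h3 := leq_div2r eta h1.
  have : wdist W H r v %/ eta <= (1 * eta + lo) %/ eta by apply: leq_div2r; lia.
  by rewrite divnMDl // => h4; lia.
have Ex : band H x a x = (lo %/ eta + a) %/ 3 by apply: bandP; rewrite /lo; lia.
move=> y n xy nrho; exists n; rewrite -/H.
(* Depths are measured within [H], so the walk is followed vertex by vertex: [pad] keeps the next
   vertex in [H], and a walk in [H] of length at most [rho] then bounds its depth. *)
elim: xy nrho => [_ _|{}y z {}n xy IH yz _ nrho]; first exact: walk0.
have Hz : H z by apply: pad nrho; exact: walkS xy yz _.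
have wy := IH (leq_trans (leq_addr _ _) nrho).
apply: (walkS wy yz); split => //; rewrite Ex; apply: bandP.
have wz : walk W H x z (n + W y z).
  by apply: (walkS _ yz) => //; apply: walk_sub wy => u [].
have := wdist_lip cH Hr wz; have := wdist_lip' W_sym cH Hr wz.
by rewrite /lo; lia.
Qed.

End Decomposition.

(** * Integer embedding of finitely many points of a graph *)

Section ShortEdges.
Variables (G : sgraph) (W : G -> G -> nat).
Hypothesis W_sym : forall x y : G, adj x y -> W x y = W y x.
Variable eta : nat.

Definition short_adj : rel G := fun x y => adj x y && (W x y <= eta).

Lemma short_adj_sym : symmetric short_adj.
Proof.
by move=> x y; rewrite /short_adj (adj_sym x y); case: (boolP (adj y x)) => // /W_sym ->.
Qed.

Lemma short_adj_irr : irreflexive short_adj.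
Proof. by move=> x; rewrite /short_adj adj_irr. Qed.

Definition short_graph := SGraph short_adj_sym short_adj_irr.

Lemma walk_short_sub (H : set G) (x y : G) n :
  walk (G := short_graph) W H x y n -> walk W H x y n.
Proof.
elim=> [|{}y z {}n _ IH /andP[yz _] Hz]; first exact: walk0.
exact: walkS IH yz Hz.
Qed.

Lemma walk_short (H : set G) (x y : G) n : walk W H x y n -> n <= eta ->
  walk (G := short_graph) W H x y n.
Proof.
elim=> [Hx _|{}y z {}n _ IH yz Hz ne]; first exact: walk0.
apply: (walkS (IH _)) => //; first lia.
by apply/andP; split => //; lia.
Qed.

Lemma minor_short H : is_minor H short_graph -> is_minor H G.
Proof.
move=> [B [h1 h2 h3 h4]]; exists B; split => //.
  move=> u x y Bx By; have [p [xp py Bp]] := h2 u x y Bx By.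
  by exists p; split => //; apply: sub_path xp => a b /andP[].
by move=> u v /h4[x [y [Bx By /andP[xy _]]]]; exists x, y.
Qed.
End ShortEdges.

Section GraphEmbedding.
Variables (G : sgraph) (W : G -> G -> nat) (s : nat) (T : finType) (pos : T -> G).
Hypothesis W_sym : forall x y : G, adj x y -> W x y = W y x.
Hypothesis s_gt1 : 1 < s.
Hypothesis no_minor : ~ is_minor (complete_bipartite s s) G.
Hypothesis pos_conn : forall x y : T, exists n, walk W setT (pos x) (pos y) n.

Definition gdist (x y : T) := wdist W setT (pos x) (pos y).

Lemma gdist_walk x y : walk W setT (pos x) (pos y) (gdist x y).
Proof. by apply: wdist_walk. Qed.

Lemma gdist_sym x y : gdist x y = gdist y x.
Proof.
apply/eqP; rewrite eqn_leq; apply/andP.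
by split; apply: wdist_le; apply: walk_sym => //; exact: gdist_walk.
Qed.

Definition shifts (sigma : s.-tuple 'I_3) : seq nat := map (@nat_of_ord 3) sigma.

(** Taking [eta] equal to [3 * r] meets the condition [2 * r < eta] of [padded_cons] and turns the
    diameter bound [18 * s ^ 2 * eta] into [54 * s ^ 2 * r]. *)
Definition gclust r (sigma : s.-tuple 'I_3) : rel T := fun x y =>
  `[< cell (G := short_graph W_sym (3 * r)) W (3 * r) (shifts sigma) (pos x) (pos y) >].

Lemma short_sym r (x y : short_graph W_sym r) : adj x y -> W x y = W y x.
Proof. by move=> /andP[/W_sym]. Qed.

Lemma short_le r (x y : short_graph W_sym r) : adj x y -> W x y <= r.
Proof. by move=> /andP[]. Qed.

Lemma gclust_refl r sigma x : gclust r sigma x x.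
Proof. by apply/asboolP; exact: cell_self. Qed.

Lemma gclust_eq r sigma x y : gclust r sigma x y ->
  gclust r sigma x =1 gclust r sigma y.
Proof.
by move=> /asboolP xy z; rewrite /gclust -(cell_eq (@short_sym _) xy).
Qed.

Lemma gclust_diam r sigma x y : 0 < r -> gclust r sigma x y ->
  gdist x y <= 54 * s ^ 2 * r.
Proof.
move=> r0 /asboolP xy.
have [|||n nle w] := cell_diam (@short_sym _) (@short_le (3 * r)) _ s_gt1 _ _ xy.
- lia.
- by rewrite size_map size_tuple.
- by move/minor_short.
by have := wdist_le (walk_short_sub w); rewrite -/(gdist x y); lia.
Qed.

(** In each round each of the two balls forbids at most one of the three shifts, so one shift suits
    both. *)
Lemma padded_pair r r' x k : 0 < r -> 0 < r' -> exists sigma : seq 'I_3,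
  [/\ size sigma = k,
      padded (G := short_graph W_sym (3 * r)) W (3 * r)
        (map (@nat_of_ord 3) sigma) x r &
      padded (G := short_graph W_sym (3 * r')) W (3 * r')
        (map (@nat_of_ord 3) sigma) x r'].
Proof.
move=> r0 r0'; elim: k => [|k [sigma [sz p p']]].
  by exists [::]; split => //; exact: padded_nil.
have [||e he] := padded_cons (@short_sym _) _ _ p; [lia|lia|].
have [||e' he'] := padded_cons (@short_sym _) _ _ p'; [lia|lia|].
have [a [a3 ae ae']] : exists a, [/\ a < 3, a != e & a != e'].
  have [/andP[h1 h2]|n0] := boolP ((0 != e) && (0 != e')); first by exists 0.
  have [/andP[h1 h2]|n1] := boolP ((1 != e) && (1 != e')); first by exists 1.
  by exists 2; split => //; lia.
exists (Ordinal a3 :: sigma); split; first by rewrite /= sz.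
  exact: he.
exact: he'.
Qed.

Lemma gclust_pad r r' x : 0 < r -> 0 < r' -> exists sigma, forall y,
  (gdist x y <= r -> gclust r sigma x y) /\
  (gdist x y <= r' -> gclust r' sigma x y).
Proof.
move=> r0 r0'; have [sigma [/eqP sz p p']] := padded_pair (pos x) s r0 r0'.
exists (Tuple sz) => y; split=> dxy; apply/asboolP.
  by apply: p (dxy); apply: (walk_short _ (gdist_walk x y)); lia.
by apply: p' (dxy); apply: (walk_short _ (gdist_walk x y)); lia.
Qed.

Lemma graph_embedding L : 2048 * s ^ 2 <= 2 ^ L ->
  (forall x y, x != y -> 864 * s ^ 2 < gdist x y) ->
  exists f : s.-tuple 'I_3 * 'I_L * 'I_(trunc_log 2 #|T|).+1 * 'I_8 -> T -> nat,
  (forall i x y, f i x <= f i y + gdist x y) /\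
  (forall x y, x != y -> exists i, gdist x y <= 3456 * s ^ 2 * (f i x - f i y) \/
     gdist x y <= 3456 * s ^ 2 * (f i y - f i x)).
Proof.
move=> hL big.
(* With [K] equal to [54 * s ^ 2], the constants 864 and 3456 are 16 and 64 times 54, and 2048 is a
   power of two above 22 times 54. *)
have [||||||||||f [f1 f2]] :=
  @finite_embedding T (s.-tuple 'I_3) gdist (54 * s ^ 2) L gclust.
- by move=> x; apply/eqP; rewrite -leqn0; apply: wdist_le; exact: walk0.
- exact: gdist_sym.
- by move=> y x z; apply: wdist_le; apply: walk_cat (gdist_walk _ _) (gdist_walk _ _).
- by rewrite muln_gt0 expn_gt0; lia.
- lia.
- by move=> x y /big; lia.
- exact: gclust_refl.
- exact: gclust_eq.
- exact: gclust_diam.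
- exact: gclust_pad.
have E : 64 * (54 * s ^ 2) = 3456 * s ^ 2 by lia.
by exists f; split => // x y /f2; rewrite E.
Qed.

End GraphEmbedding.

Local Open Scope ring_scope.

(** * From real to integer weights *)

Section RowNorm.
Variables (R : realType) (k : nat).

Lemma row_norm_le (v : 'rV[R]_k) c : 0 <= c -> (forall j, `|v 0 j| <= c) -> `|v| <= c.
Proof.
move=> c0 vc; rewrite [`|v|]mx_normrE; apply: bigmax_le => // -[i j] _ /=.
by rewrite (ord1 i).
Qed.

Lemma row_norm_ge (v : 'rV[R]_k) j : `|v 0 j| <= `|v|.
Proof.
rewrite [`|v|]mx_normrE.
exact: (le_bigmax (T := R) 0 (fun ij : 'I_1 * 'I_k => `|v ij.1 ij.2|) (0, j)).
Qed.
End RowNorm.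

Section Rounding.
Variables (R : realType) (G : sgraph) (w : G -> G -> R) (N : nat).
Hypothesis w_pos : is_edge_weight w.

(** Rounding up makes integer lengths dominate the scaled real ones, at a cost of at most 1 per
    edge. *)
Definition rounded (x y : G) : nat := (Num.truncn (N%:R * w x y)).+1.

Lemma rounded_sym x y : adj x y -> rounded x y = rounded y x.
Proof. by move=> /w_pos[_ e]; rewrite /rounded e. Qed.

Lemma rounded_path x p : path (@adj G) x p ->
  N%:R * path_length w x p <= (sumn (pairmap rounded x p))%:R <=
  N%:R * path_length w x p + (size p)%:R.
Proof.
elim: p x => [|y p IH] x; first by rewrite /path_length big_nil mulr0 addr0 lexx.
move=> /= /andP[xy /IH /andP[h1 h2]]; have [w0 _] := w_pos xy.
have -> : path_length w x (y :: p) = w x y + path_length w y p.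
  by rewrite /path_length /= big_cons.
have := truncn_itv (mulr_ge0 (ler0n R N) (ltW w0)).
rewrite mulrDr natrD -(natr1 (size p)) /rounded -(natr1 (Num.truncn _)).
move: h1 h2; set a := N%:R * path_length w y p; set b := N%:R * w x y.
set c := (sumn _)%:R; set e := (Num.truncn b)%:R; set f := (size p)%:R.
by move=> h1 h2 /andP[h3 h4]; apply/andP; split; lra.
Qed.
End Rounding.

(** The infimum need not be attained, so each of the finitely many pairs gets a walk of length at
    most [2 * d x y]. [N] is so large that [N * d x y] exceeds both [B] and the number of edges of
    these walks; the rounding error then turns 2 into at most 3. *)
Lemma rounded_metric (R : realType) (G : sgraph) (w : G -> G -> R) (T : finType)
    (pos : T -> G) (d : T -> T -> R) (B : nat) :
  is_edge_weight w ->
  (forall x y, (d x y)%:E = path_dist w (pos x) (pos y)) ->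
  (forall x, d x x = 0) -> (forall x y, x != y -> 0 < d x y) ->
  exists N : nat, [/\ (0 < N)%N,
    forall x y, exists n, walk (rounded w N) setT (pos x) (pos y) n,
    forall x y, N%:R * d x y <= (gdist (rounded w N) pos x y)%:R <= 3 * (N%:R * d x y) &
    forall x y, x != y -> (B < gdist (rounded w N) pos x y)%N].
Proof.
move=> w_pos dE d0 d_pos.
have /choice[p pP] : forall xy : T * T, exists p, [/\ path (@adj G) (pos xy.1) p,
    last (pos xy.1) p = pos xy.2 & path_length w (pos xy.1) p <= 2 * d xy.1 xy.2].
  move=> [x y] /=; have [<-|nxy] := eqVneq x y.
    by exists [::]; rewrite /path_length big_nil d0 mulr0.
  have : (path_dist w (pos x) (pos y) < (2 * d x y)%:E)%E.
    by rewrite -dE lte_fin; have := d_pos _ _ nxy; lra.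
  move=> /ereal_inf_lt[_ [q [xq qy] <-]]; rewrite lte_fin => /ltW h.
  by exists q.
have d_ge0 x y : 0 <= d x y.
  by have [->|/d_pos/ltW//] := eqVneq x y; rewrite d0.
pose M := \max_xy size (p xy).
pose N := (\max_(xy : T * T) (Num.truncn ((M + B).+1%:R / d xy.1 xy.2)).+1).+1.
have NP x y : x != y -> (M + B).+1%:R <= N%:R * d x y.
  move=> nxy; rewrite -ler_pdivrMr ?d_pos //.
  apply: le_trans (ltW (truncnS_gt _)) _; rewrite ler_nat.
  exact: leqW (leq_bigmax (F := fun xy : T * T =>
    (Num.truncn ((M + B).+1%:R / d xy.1 xy.2)).+1) (x, y)).
have wk x y : walk (rounded w N) setT (pos x) (pos y)
    (sumn (pairmap (rounded w N) (pos x) (p (x, y)))).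
  have [h1 h2 _] := pP (x, y); rewrite /= in h1 h2.
  by rewrite -h2; exact: path_walk.
have cn x y : exists n, walk (rounded w N) setT (pos x) (pos y) n by eexists; exact: wk.
have lo x y : N%:R * d x y <= (gdist (rounded w N) pos x y)%:R.
  have [q [xq qy _ ->]] := walk_path (gdist_walk cn x y).
  have /andP[h _] := rounded_path N w_pos xq; apply: le_trans h.
  rewrite ler_wpM2l // -lee_fin dE; apply: ereal_inf_lbound.
  by exists q.
exists N; split => //.
- move=> x y; rewrite lo /=; have [->|nxy] := eqVneq x y.
    have -> : gdist (rounded w N) pos y y = 0%N.
      by apply/eqP; rewrite -leqn0; apply: wdist_le; exact: walk0.
    by rewrite d0 !mulr0.
  have h1 : (gdist (rounded w N) pos x y)%:R <=
      (sumn (pairmap (rounded w N) (pos x) (p (x, y))))%:R :> R.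
    by rewrite ler_nat; apply: wdist_le; exact: wk.
  have [/= xp _ h2] := pP (x, y).
  have /andP[_ h3] := rounded_path N w_pos xp.
  have h4 : N%:R * path_length w (pos x) (p (x, y)) <= N%:R * (2 * d x y).
    by rewrite ler_wpM2l.
  have h5 : (size (p (x, y)))%:R <= (M + B).+1%:R :> R.
    rewrite ler_nat -addnS; apply: leq_trans (leq_addr _ _).
    exact: (leq_bigmax (F := fun xy : T * T => size (p xy)) (x, y)).
  have h6 := NP x y nxy.
  apply: (le_trans h1); apply: (le_trans h3).
  rewrite mulrCA in h4; lra.
- move=> x y nxy; rewrite -(ltr_nat R); apply: lt_le_trans (lo x y).
  by apply: lt_le_trans (NP x y nxy); rewrite ltr_nat; lia.
Qed.

(** * Attainment of the least distortion *)

Section MinimalDistortion.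
Variables (R : realType) (X : metricType R) (n k : nat) (f : X -> 'rV[R]_k).
Variables (g : 'I_n -> X) (h : X -> 'I_n).
Hypotheses (hK : cancel h g) (gK : cancel g h) (n_gt1 : (1 < n)%N).

Lemma distortion_le_inj K : distortion_le f K -> injective f.
Proof.
move=> [K0 [c c0 fP]] x y fxy; apply/eqP; apply: contraT => nxy.
have /andP[+ _] := fP x y; rewrite fxy subrr normr0 leNgt.
by rewrite !mulr_gt0 ?invr_gt0 // mdist_gt0.
Qed.

(** On a finite space the least distortion is the largest ratio of norm to distance divided by the
    smallest; the given bound [K0] makes the smallest positive. *)
Lemma minimal_distortion K0 : distortion_le f K0 ->
  exists2 K, is_distortion f K & K <= K0.
Proof.
move=> dK0; suff [K dK] : exists K, is_distortion f K.
  by exists K => //; case: dK => _; exact.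
pose P := [pred p : 'I_n * 'I_n | p.1 != p.2].
pose F (p : 'I_n * 'I_n) := `|f (g p.1) - f (g p.2)| / mdist (g p.1) (g p.2).
pose p0 : 'I_n * 'I_n := (Ordinal (ltnW n_gt1), Ordinal n_gt1).
have P0 : P p0 by [].
have dP p : P p -> 0 < mdist (g p.1) (g p.2).
  by move=> Pp; rewrite mdist_gt0; apply: contra Pp => /eqP/(can_inj gK) ->.
case: (arg_maxP F P0) => pM PM maxM; case: (arg_minP F P0) => pm Pm minm.
have ltF p c K : P p -> 0 < c * K^-1 ->
    c * K^-1 * mdist (g p.1) (g p.2) <= `|f (g p.1) - f (g p.2)| <=
      c * mdist (g p.1) (g p.2) ->
    c * K^-1 <= F p <= c.
  by move=> Pp cK; rewrite /F ler_pdivlMr ?dP // ler_pdivrMr ?dP.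
have m0 : 0 < F pm.
  case: dK0 => K0p [c c0 /(_ (g pm.1) (g pm.2)) hc].
  have cK : 0 < c * K0^-1 by rewrite mulr_gt0 ?invr_gt0.
  by have /andP[h1 _] := ltF _ _ _ Pm cK hc; exact: lt_le_trans h1.
have M0 : 0 < F pM by apply: lt_le_trans m0 _; exact: minm.
exists (F pM / F pm); split.
  split; first by rewrite divr_gt0.
  exists (F pM) => // x y; have [->|nxy] := eqVneq x y.
    by rewrite mdistxx subrr normr0 !mulr0 lexx.
  have Pxy : P (h x, h y).
    by rewrite /= ; apply: contra nxy => /eqP/(can_inj hK) ->.
  have Fxy : F (h x, h y) = `|f x - f y| / mdist x y by rewrite /F /= !hK.
  have h2 := minm _ Pxy; have h1 := maxM _ Pxy; rewrite /= Fxy in h1 h2.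
  have d0 : 0 < mdist x y by rewrite mdist_gt0.
  rewrite invf_div mulrCA divff ?mulr1 ?gt_eqF //.
  by apply/andP; split; [rewrite -ler_pdivlMr|rewrite -ler_pdivrMr].
move=> K' [K'0 [c c0 hc]].
have cK : 0 < c * K'^-1 by rewrite mulr_gt0 ?invr_gt0.
have /andP[_ h1] := ltF _ _ _ PM cK (hc _ _).
have /andP[h2 _] := ltF _ _ _ Pm cK (hc _ _).
rewrite ler_pdivrMr //; apply: (le_trans h1).
by rewrite mulrC -ler_pdivrMr.
Qed.
End MinimalDistortion.

(** * Counting coordinates and assembling the bounds *)

Lemma trunc_log_ln (R : realType) n : (0 < n)%N ->
  (trunc_log 2 n)%:R * ln 2 <= ln n%:R :> R.
Proof.
move=> n0; rewrite mulr_natl -lnXn // ler_ln ?posrE ?exprn_gt0 ?ltr0n //.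
by rewrite -natrX ler_nat; case/andP: (trunc_log_bounds (isT : (1 < 2)%N) n0).
Qed.

Lemma card_ord_bij (X : Type) n : ([set: X] #= `I_n)%card ->
  exists (h : X -> 'I_n) (g : 'I_n -> X), cancel h g /\ cancel g h.
Proof.
move=> /card_set_bijP[f [ff finj fsurj]].
have fn x : (f x < n)%N by exact: (ff x I).
pose h x := Ordinal (fn x).
have /choice[g gP] : forall i : 'I_n, exists x, h x = i.
  by move=> i; have [x _ fx] := fsurj i (ltn_ord i); exists x; exact: val_inj.
exists h, g; split => [x|i]; last exact: gP.
by apply: finj; rewrite ?inE //; have := congr1 val (gP (h x)).
Qed.

Lemma dimension_bound (R : realType) s n : (1 < s)%N -> (1 < n)%N ->
  (3 ^ s * (13 + 2 * trunc_log 2 s) * (trunc_log 2 n).+1 * 8)%:R <=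
  240 / ln 2 ^+ 2 * 3 ^+ s * ln s%:R * ln n%:R :> R.
Proof.
move=> s1 n1.
have l2 : 0 < ln 2 :> R by rewrite ln_gt0 // ltr1n.
have ts : (0 < trunc_log 2 s)%N by rewrite trunc_log_gt0.
have tn : (0 < trunc_log 2 n)%N by rewrite trunc_log_gt0.
have hs := trunc_log_ln R (ltnW s1); have hn := trunc_log_ln R (ltnW n1).
(* 240 is 15 * 2 * 8: both logarithms are at least 1, so 13 + 2 and 1 + 1 absorb the additive
   constants. *)
apply: (@le_trans _ _ (240 * (3 ^ s)%N%:R * (trunc_log 2 s)%:R * (trunc_log 2 n)%:R)).
  rewrite -[240]/(240%:R) -!natrM ler_nat.
  have h1 : (13 + 2 * trunc_log 2 s <= 15 * trunc_log 2 s)%N by lia.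
  have h2 : ((trunc_log 2 n).+1 <= 2 * trunc_log 2 n)%N by lia.
  have := leq_mul (leq_mul (leqnn (3 ^ s)) h1) h2.
  by clear; move: (trunc_log 2 s) (trunc_log 2 n) (3 ^ s)%N => b c e; lia.
rewrite natrX.
have -> : 240 * 3%:R ^+ s * (trunc_log 2 s)%:R * (trunc_log 2 n)%:R =
  240 / ln 2 ^+ 2 * 3 ^+ s *
    (((trunc_log 2 s)%:R * ln 2) * ((trunc_log 2 n)%:R * ln 2)) :> R.
  by field; rewrite gt_eqF.
rewrite -[leRHS]mulrA; apply: ler_wpM2l.
  by apply: mulr_ge0; [exact: divr_ge0 (ler0n _ _) (exprn_ge0 _ (ltW l2))
                      |exact: exprn_ge0 (ler0n _ _)].
by apply: ler_pM => //; rewrite mulr_ge0 // ltW.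
Qed.

Theorem theorem3p1 (R : realType) :
  exists C1 C2 : R, [/\ 0 < C1, 0 < C2 &
    forall (s n : nat) (X : metricType R),
      (2 <= s)%N -> (2 <= n)%N -> ([set: X] #= `I_n)%card ->
      excludes_minor X (complete_bipartite s s) ->
      exists (k : nat) (f : X -> 'rV[R]_k) (K : R),
        [/\ k%:R <= C1 * 3 ^+ s * ln s%:R * ln n%:R,
            injective f, is_distortion f K & K <= C2 * s%:R ^+ 2]].
Proof.
have [A A0 dim] : exists2 A : R, 0 < A & forall s n, (1 < s)%N -> (1 < n)%N ->
    (3 ^ s * (13 + 2 * trunc_log 2 s) * (trunc_log 2 n).+1 * 8)%:R <=
    A * 3 ^+ s * ln s%:R * ln n%:R.
  exists (240 / ln 2 ^+ 2); last exact: dimension_bound.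
  by apply: divr_gt0; [rewrite ltr0n|apply/exprn_gt0/ln_gt0; rewrite ltr1n].
have [c cE] : exists c : nat, c = 3456%N by eexists.
have c0 : 0 < c%:R :> R by rewrite ltr0n cE.
(* [c] is the constant of [graph_embedding]; the factor 3 is the loss from rounding the weights. *)
exists A, (3 * c%:R); split; [exact: A0|exact: mulr_gt0|].
move=> s n X s1 n1 /card_ord_bij[h [g [hK gK]]] [G [w [i [w_pos noM i_inj dE]]]].
pose pos := i \o g.
have [|||N [N0 cn lohi big]] := @rounded_metric R G w 'I_n pos
  (fun a b => mdist (g a) (g b)) (864 * s ^ 2)%N w_pos.
- by move=> a b; exact: dE.
- by move=> a; exact: mdistxx.
- by move=> a b ab; rewrite mdist_gt0; apply: contra ab => /eqP/(can_inj gK) ->.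
(* 13 is 11 + 2: [2 ^ 11] is 2048, and [2 ^ (2 + 2 * trunc_log 2 s)] is at least [s ^ 2]. *)
pose L := (13 + 2 * trunc_log 2 s)%N.
have hL : (2048 * s ^ 2 <= 2 ^ L)%N.
  have /andP[_ h2] := trunc_log_bounds (isT : (1 < 2)%N) (ltnW s1).
  have -> : (2 ^ L = 2048 * (2 ^ (trunc_log 2 s).+1) ^ 2)%N.
    by rewrite /L -expnM -[2048%N]/(2 ^ 11)%N -expnD; congr (2 ^ _)%N; lia.
  by rewrite leq_mul2l leq_exp2r // ltnW.
have [F [F1 F2]] := graph_embedding (@rounded_sym R G w N w_pos) s1 noM cn hL big.
rewrite -cE in F2.
pose I := (s.-tuple 'I_3 * 'I_L * 'I_(trunc_log 2 #|'I_n|).+1 * 'I_8)%type.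
pose f (x : X) : 'rV[R]_#|{: I}| := \row_j (F (enum_val j) (h x))%:R.
have s0 : 0 < s%:R ^+ 2 :> R by rewrite exprn_gt0 // ltr0n ltnW.
have cs0 : 0 < c%:R * s%:R ^+ 2 :> R by exact: mulr_gt0.
have dist_f : distortion_le f (3 * c%:R * s%:R ^+ 2).
  split; first by rewrite mulr_gt0 // mulr_gt0.
  (* Coordinates are 1-Lipschitz for [gdist], which is at most [3 * N] times the original
     distance. *)
  exists (3 * N%:R); first by rewrite mulr_gt0 // ltr0n.
  move=> x y; have := lohi (h x) (h y); rewrite !hK.
  set D := gdist _ _ _ _ => /andP[lo hi]; apply/andP; split; last first.
    apply: row_norm_le; first by rewrite !mulr_ge0 // mdist_ge0.
    move=> j; apply: le_trans (_ : D%:R <= _); last by rewrite -mulrA.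
    have h1 := F1 (enum_val j) (h x) (h y); have h2 := F1 (enum_val j) (h y) (h x).
    rewrite (gdist_sym (@rounded_sym R G w N w_pos) cn) in h2.
    rewrite !mxE ler_norml; apply/andP; split.
      by rewrite lerBrDl lerBlDr -natrD ler_nat.
    by rewrite lerBlDr -natrD ler_nat addnC.
  have [->|nxy] := eqVneq x y; first by rewrite mdistxx mulr0.
  have hxy : h x != h y by apply: contra nxy => /eqP/(can_inj hK) ->.
  have -> : 3 * N%:R * (3 * c%:R * s%:R ^+ 2)^-1 * mdist x y =
      N%:R * mdist x y / (c%:R * s%:R ^+ 2).
    by field; rewrite !gt_eqF // ltr0n ltnW.
  rewrite ler_pdivrMr //; apply: (le_trans lo).
  have [j hj] := F2 _ _ hxy.
  apply: (le_trans _ (ler_wpM2r _ (row_norm_ge (f x - f y) (enum_rank j)))); last first.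
    exact: ltW.
  rewrite !mxE enum_rankK mulrC.
  have natE m : (D <= c * s ^ 2 * m)%N -> D%:R <= c%:R * s%:R ^+ 2 * m%:R :> R.
    by rewrite -natrX -!natrM ler_nat.
  have up (a b : nat) : (a - b)%N%:R <= `|a%:R - b%:R| :> R.
    have [ab|/ltnW ba] := leqP a b; last by rewrite natrB // ler_norm.
    by move: ab; rewrite -subn_eq0 => /eqP ->; exact: normr_ge0.
  case: hj => /natE hj; apply: (le_trans hj).
    by apply: ler_wpM2l (up _ _); exact: ltW.
  by rewrite distrC; apply: ler_wpM2l (up _ _); exact: ltW.
have [K dK K_le] := minimal_distortion hK gK n1 dist_f.
exists #|{: I}|, f, K; split=> //; last exact: distortion_le_inj dist_f.
by rewrite !card_prod card_tuple !card_ord; exact: dim.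
Qed.
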